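(* Let $n\in\mathbb{N}$, let $\mathbf{i}=(i_1,\dots,i_n)$ be a weight vector, and let $\boldsymbol{\alpha}=(\alpha_1,\dots,\alpha_n)\in\mathbb{R}^n$ be a vector that is not $\mathbf{i}$-singular, i.e. $\boldsymbol{\alpha}\notin\mathcal{S}_n(\mathbf{i})$. Then for Lebesgue-almost all $\boldsymbol{\beta}=(\beta_1,\dots,\beta_n)\in[0,1]^n$, $$\liminf_{q\to\infty}\ \max_{1\le j\le n}q^{i_j}\|q\alpha_j-\beta_j\|=0,$$ where $q$ runs over the positive integers.
   Context: For a real number $x$, $\|x\|$ denotes the distance from $x$ to the nearest integer. A weight vector is $\mathbf{i}=(i_1,\dots,i_n)\in\mathbb{R}^n$ with $0\le i_j\le 1$ for all $j$ and $i_1+\dots+i_n=1$. A vector $\boldsymbol{\alpha}\in\mathbb{R}^n$ is $\mathbf{i}$-singular, written $\boldsymbol{\alpha}\in\mathcal{S}_n(\mathbf{i})$, if for every (arbitrarily small) constant $c>0$ and for all sufficiently large $Q\in\mathbb{N}$ (depending on $c$) there is an integer $q$ with $1\le q\le Q$ and $$\|q\alpha_j\|<c\,Q^{-i_j}\quad\text{for all }j\in\{1,\dots,n\}.$$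
   Formalization: When some weight i_j is zero, the numbers 1, α_1,…,α_n are additionally assumed linearly independent over the rationals; without this the claim fails, e.g. for n=2, i=(1,0), α=(√2,0). *)

(* Defs.v *)
From HB Require Import structures.
From mathcomp Require Import all_boot all_order all_algebra.
From mathcomp Require Import all_classical all_reals all_analysis.

Set Implicit Arguments.
Unset Strict Implicit.
Unset Printing Implicit Defensive.

Import Order.TTheory GRing.Theory Num.Theory.
Import numFieldNormedType.Exports.

Local Open Scope classical_set_scope.
Local Open Scope ring_scope.

Section LebesgueTuple.
Variable R : realType.
Local Notation RM := (measurableTypeR R).

Definition pair_cons n (x : RM * n.-tuple RM) : n.+1.-tuple RM :=
  [the n.+1.-tuple RM of x.1 :: x.2].

Lemma measurable_pair_cons n : measurable_fun [set: RM * n.-tuple RM] (@pair_cons n).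
Proof. exact: (measurable_cons measurable_fst measurable_snd). Qed.

Definition uncons n (t : n.+1.-tuple RM) : RM * n.-tuple RM :=
  (thead t, [tuple of behead t]).

Lemma measurable_uncons n : measurable_fun [set: n.+1.-tuple RM] (@uncons n).
Proof.
apply: measurable_fun_pair; first exact: measurable_tnth.
exact: measurable_behead.
Qed.

Lemma pair_consK n : cancel (@pair_cons n) (@uncons n).
Proof. by move=> [x t]; congr pair; exact: val_inj. Qed.

Section LebesgueCons.
Local Open Scope ereal_scope.
Variables (n : nat) (m : {sigma_finite_measure set (n.-tuple RM) -> \bar R}).

Definition lebesgue_cons : set (n.+1.-tuple RM) -> \bar R :=
  pushforward (@lebesgue_measure R \x m) (@pair_cons n).

Let lebesgue_cons0 : lebesgue_cons set0 = 0.
Proof. by rewrite /lebesgue_cons /pushforward preimage_set0 measure0. Qed.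

Let lebesgue_cons_ge0 A : 0 <= lebesgue_cons A.
Proof. by rewrite /lebesgue_cons /pushforward; exact: measure_ge0. Qed.

Let lebesgue_cons_sigma_additive : semi_sigma_additive lebesgue_cons.
Proof.
have mc := @measurable_pair_cons n.
move=> F mF tF mUF; rewrite /lebesgue_cons /pushforward preimage_bigcup.
apply: measure_semi_sigma_additive.
- by move=> k; rewrite -[X in measurable X]setTI; exact: mc.
- apply/trivIsetP => i j _ _ ij; rewrite -preimage_setI.
  by move/trivIsetP : tF => /(_ _ _ _ _ ij) ->//; rewrite preimage_set0.
- by rewrite -preimage_bigcup -[X in measurable X]setTI; exact: mc.
Qed.

HB.instance Definition _ := isMeasure.Build _ _ _ lebesgue_cons
  lebesgue_cons0 lebesgue_cons_ge0 lebesgue_cons_sigma_additive.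

Let lebesgue_cons_sigma_finite : sigma_finite setT lebesgue_cons.
Proof.
have /sigma_finiteP[F [TF ndF Foo]] := sigma_finiteT (@lebesgue_measure R).
have /sigma_finiteP[G [TG ndG Goo]] := sigma_finiteT m.
exists (fun k => @uncons n @^-1` (F k `*` G k)).
  rewrite -preimage_bigcup; apply/esym; rewrite -subTset => t _ /=.
  have [i _ Fi] : (\bigcup_i F i) (uncons t).1 by rewrite -TF.
  have [j _ Gj] : (\bigcup_i G i) (uncons t).2 by rewrite -TG.
  exists (maxn i j) => //; split.
  - by move: Fi; exact/subsetPset/ndF/leq_maxl.
  - by move: Gj; exact/subsetPset/ndG/leq_maxr.
move=> k; have [mF Fk] := Foo k; have [mG Gk] := Goo k.
have mFG : measurable (F k `*` G k) by exact: measurableX.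
split; first by rewrite -[X in measurable X]setTI; exact: measurable_uncons.
rewrite /lebesgue_cons /pushforward -comp_preimage.
rewrite (_ : _ \o _ = id); last by apply/funext => x; exact: pair_consK.
by rewrite product_measure1E// lte_mul_pinfty// ge0_fin_numE.
Qed.

HB.instance Definition _ := Measure_isSigmaFinite.Build _ _ _ lebesgue_cons
  lebesgue_cons_sigma_finite.

End LebesgueCons.

Fixpoint lebesgue_tuple n : {sigma_finite_measure set (n.-tuple RM) -> \bar R} :=
  if n is k.+1 then lebesgue_cons (lebesgue_tuple k) else \d_[tuple].

Lemma lebesgue_tuple_box n (A : 'I_n -> set RM) :
  (forall j, measurable (A j)) ->
  lebesgue_tuple n [set t | forall j, A j (tnth t j)] =
  (\prod_(j < n) lebesgue_measure (A j))%E.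
Proof.
elim: n A => [|n IHn] A mA.
  by rewrite big_ord0 /= diracE mem_set// => -[].
pose B := [set t : n.-tuple RM | forall j, A (lift ord0 j) (tnth t j)].
have mB : measurable B.
  rewrite (_ : B = \bigcap_(j in [set: 'I_n]) (@tnth n RM ^~ j @^-1` A (lift ord0 j))).
    apply: fin_bigcap_measurable => // j _.
    by rewrite -[X in measurable X]setTI; apply: measurable_tnth.
  by apply/seteqP; split => t /= Bt j; [move=> _|]; exact: Bt.
rewrite big_ord_recl /= -IHn// -product_measure1E//.
rewrite /lebesgue_cons /pushforward; congr (_ _).
apply/seteqP; split => -[x t] /=.
- move=> h; split; first exact: (h ord0).
  by move=> j; have := h (lift ord0 j); rewrite tnthS.
- move=> [Ax Bt] j; case: (unliftP ord0 j) => [k ->|->]//.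
  by rewrite tnthS; exact: Bt.
Qed.

End LebesgueTuple.

Section Diophantine.
Variable R : realType.

Definition dist_int (x : R) : R := inf [set `|x - m%:~R| | m in [set: int]].

Definition weight_vector n (w : n.-tuple R) : Prop :=
  (forall j, 0 <= tnth w j <= 1) /\ \sum_(j < n) tnth w j = 1.

Definition singular n (w a : n.-tuple R) : Prop :=
  forall c : R, 0 < c -> \forall Q \near \oo,
    exists2 q : nat, (1 <= q <= Q)%N &
      forall j, dist_int (q%:R * tnth a j) < c * Q%:R `^ (- tnth w j).

(* Linear independence over the rationals of 1, a_1, ..., a_n (denominators
   cleared). It matters only for weight vectors with a zero entry: for
   w = (1, 0), the nonsingular vector a = (sqrt 2, 0) would otherwise require
   q%:R * 0 to approach b_2 modulo 1 for almost every b. *)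
Definition rat_independent1 n (a : n.-tuple R) : Prop :=
  forall (m : 'I_n -> int) (k : int),
    \sum_(j < n) (m j)%:~R * tnth a j = k%:~R -> forall j, m j = 0.

(* All the terms are nonnegative, so the default value 0 of the maximum is
   harmless. *)
Definition inhom_max n (w a b : n.-tuple R) (q : nat) : R :=
  \big[Num.max/0]_(j < n)
    (q%:R `^ tnth w j * dist_int (q%:R * tnth a j - tnth b j)).

End Diophantine.

(* Main.v *)
Require Import Defs.
From mathcomp Require Import all_boot all_order all_algebra.
From mathcomp Require Import all_classical all_reals all_analysis.
From mathcomp Require Import complex ring lra zify.

Set Implicit Arguments.
Unset Strict Implicit.
Unset Printing Implicit Defensive.

Import Order.TTheory GRing.Theory Num.Theory.
Import numFieldNormedType.Exports.

Local Open Scope classical_set_scope.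
Local Open Scope ring_scope.

(** Let [X] be the set of the [b] that are not approximated within
    [e * q ^ - w j] by [q a] for large [q]. It is invariant under integer
    translations and mapped into itself by the translation by [a]. A nonsingular
    [a] is rationally independent of [1]: this is assumed when some weight
    vanishes, and follows from Dirichlet's theorem otherwise. By Kronecker's
    theorem, the measure of [X] in any box of sides [d j / 2] is then at most its
    measure in any box of sides [d j]. Nonsingularity gives arbitrarily large [Q]
    for which the [Q] boxes of sides [d j = e * Q ^ - w j] at [a, ..., Q a] are
    disjoint modulo 1, and their total volume [e ^ n] does not depend on [Q].
    They meet [X] in a set whose measure tends to 0, since a point of the box at
    [q a] is approximated by [q a]. As the unit cube is covered by
    [O(Q / e ^ n)] half-size boxes, [X] is null. *)

(** * Kronecker's theorem *)

Section Kronecker.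
Variable R : realType.
Local Open Scope complex_scope.

Lemma cos_2piD_int (y : R) (m : int) :
  cos (2 * pi * (y + m%:~R)) = cos (2 * pi * y).
Proof.
have pos (z : R) k : cos (2 * pi * (z + k%:R)) = cos (2 * pi * z).
  have -> : 2 * pi * (z + k%:R) = 2 * pi * z + (pi *+ 2) *+ k.
    by rewrite mulrDr mulr_natr -(mulr_natl pi 2).
  by rewrite (periodicn (@cosD2pi R)).
case: m => k; first exact: pos.
by rewrite NegzE -[in RHS](subrK k.+1%:R y) pos.
Qed.

Lemma cos_2pi_lt1 (d : R) : 0 < d -> d <= 2^-1 -> cos (2 * pi * d) < 1.
Proof.
move=> d0 d2; have pi0 := pi_gt0 R; rewrite -[ltRHS]cos0 ltr_cos ?in_itv/= ?lexx ?(ltW pi0)//.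
  by rewrite !mulr_gt0.
by apply/andP; split; nra.
Qed.

(** Periodicity puts [y] in [[d, 1 - d]], the reflection [y -> 1 - y] puts it in [[d, 1/2]], and
    there [cos (2 pi y)] is decreasing. *)
Lemma cos_2pi_away_int (d y : R) : 0 < d -> (forall m : int, d <= `|y - m%:~R|) ->
  cos (2 * pi * y) <= cos (2 * pi * d).
Proof.
move=> d0 dy; have pi0 := pi_gt0 R.
pose y' := y - (Num.floor y)%:~R.
have y'0 : 0 <= y' by rewrite subr_ge0 Num.Theory.floor_le.
have y'1 : y' < 1 by rewrite ltrBlDl; have := floorD1_gt y; rewrite intrD.
have -> : cos (2 * pi * y) = cos (2 * pi * y').
  by rewrite -(cos_2piD_int y' (Num.floor y)) /y' subrK.
have dy' : d <= y' by have := dy (Num.floor y); rewrite ger0_norm.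
have dy1 : d <= 1 - y'.
  have := dy (Num.floor y + 1); rewrite intrD /= opprD addrA -/y'.
  by rewrite ltr0_norm ?subr_lt0// opprB.
have bound (x : R) : d <= x -> x <= 2^-1 -> cos (2 * pi * x) <= cos (2 * pi * d).
  move=> dx x2; have [->//|/eqP ndx] := eqVneq d x.
  have ldx : d < x by rewrite lt_neqAle dx andbT; apply/eqP.
  apply/ltW; rewrite ltr_cos ?in_itv/=; first by rewrite ltr_pM2l ?mulr_gt0.
    by apply/andP; split; nra.
  by apply/andP; split; nra.
have [y2|/ltW y2] := leP y' 2^-1; first exact: bound.
have -> : cos (2 * pi * y') = cos (2 * pi * (1 - y')).
  rewrite -cosN -(cos_2piD_int (1 - y') (-1)); congr cos; rewrite intrN; ring.
apply: bound => //; lra.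
Qed.

(** The character [exp (2 pi i t)] of the reals modulo 1. *)
Definition expi (t : R) : R[i] := cos (2 * pi * t) +i* sin (2 * pi * t).

Lemma expiD s t : expi (s + t) = expi s * expi t.
Proof.
rewrite /expi mulrDr cosD sinD; apply/eqP; rewrite eq_complex /=.
by apply/andP; split; apply/eqP; ring.
Qed.

Lemma expi0 : expi 0 = 1.
Proof. by rewrite /expi mulr0 cos0 sin0. Qed.

Lemma expi_sum (I : finType) (F : I -> R) :
  expi (\sum_i F i) = \prod_i expi (F i).
Proof. exact: (big_morph expi expiD expi0). Qed.

Lemma expiX t n : expi (t *+ n) = expi t ^+ n.
Proof. by elim: n => [|n IH]; rewrite ?expi0// mulrS exprS expiD IH. Qed.

Lemma normc_expi t : Normc.normc (expi t) = 1.
Proof. by rewrite /expi /= cos2Dsin2 sqrtr1. Qed.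

Lemma normc1Dexpi t :
  Normc.normc (1 + expi t) = Num.sqrt (2 + 2 * cos (2 * pi * t)).
Proof.
rewrite /expi /= add0r; congr Num.sqrt.
by have := cos2Dsin2 (2 * pi * t); set c := cos _; set s := sin _ => h; nra.
Qed.

(** A non-integer [t] has a positive distance [d] to the integers, so
    [cos (2 pi t) <= cos (2 pi d) < 1]. *)
Lemma expi_eq1 t : expi t = 1 -> exists k : int, t = k%:~R.
Proof.
move=> /(congr1 (@complex.Re R)) /= cos1.
apply: contrapT => nt.
pose d := Num.min (t - (Num.floor t)%:~R) ((Num.floor t)%:~R + 1 - t).
have d0 : 0 < d.
  rewrite lt_min !subr_gt0; apply/andP; split.
    rewrite lt_neqAle Num.Theory.floor_le andbT; apply/eqP => h; apply: nt.
    by exists (Num.floor t).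
  by have := floorD1_gt t; rewrite intrD.
have dt : forall m : int, d <= `|t - m%:~R|.
  move=> m; have [mt|mt] := leP m (Num.floor t).
    have : m%:~R <= (Num.floor t)%:~R :> R by rewrite ler_int.
    move=> mt'; rewrite ge_min; apply/orP; left.
    by rewrite ger0_norm ?lerB// subr_ge0 (le_trans mt')// Num.Theory.floor_le.
  have : (Num.floor t + 1)%:~R <= m%:~R :> R by rewrite ler_int -ltzD1 ltrD2r.
  rewrite intrD => mt'; rewrite ge_min; apply/orP; right.
  rewrite ler0_norm ?opprB ?lerB// subr_le0 (le_trans _ mt')// ltW//.
  by have := floorD1_gt t; rewrite intrD.
have d2 : d <= 2^-1.
  by rewrite ge_min; case: leP => //= h; rewrite leNgt; apply/negP => h'; lra.
have := cos_2pi_away_int d0 dt; rewrite cos1 leNgt => /negP; apply.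
by rewrite cos_2pi_lt1.
Qed.

Lemma normc_sum (I : finType) (P : pred I) (F : I -> R[i]) :
  Normc.normc (\sum_(i | P i) F i) <= \sum_(i | P i) Normc.normc (F i).
Proof.
elim/big_ind2: _ => [|x1 x2 y1 y2 h1 h2|//]; first by rewrite Normc.normc0.
by rewrite (le_trans (le_normcD _ _))// lerD.
Qed.

Lemma normc_real (x : R) : Normc.normc x%:C = `|x|.
Proof. by rewrite /= expr0n /= addr0 sqrtr_sqr. Qed.

Lemma normc_ge0 (x : R[i]) : 0 <= Normc.normc x.
Proof. by case: x => a b /=; exact: sqrtr_ge0. Qed.

Lemma normcX (x : R[i]) k : Normc.normc (x ^+ k) = Normc.normc x ^+ k.
Proof.
by elim: k => [|k IH]; rewrite ?Normc.normc1// !exprS Normc.normcM IH.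
Qed.

Lemma normc_prod (I : finType) (F : I -> R[i]) :
  Normc.normc (\prod_i F i) = \prod_i Normc.normc (F i).
Proof. exact: (big_morph _ (@Normc.normcM R) (@Normc.normc1 R)). Qed.

(** Multiplied by [u - 1] the sum telescopes to [u ^ M - 1], of modulus at most 2. The bound does
    not depend on [M]. *)
Lemma geometric_bound (u : R[i]) M : Normc.normc u = 1 -> u != 1 ->
  Normc.normc (\sum_(q < M) u ^+ q) <= 2 / Normc.normc (u - 1).
Proof.
move=> u1 nu; have pos : 0 < Normc.normc (u - 1).
  rewrite lt_neqAle normc_ge0 andbT eq_sym; apply: contra nu => /eqP h.
  by rewrite -subr_eq0; apply/eqP; exact: Normc.eq0_normc.
rewrite ler_pdivlMr// mulrC -Normc.normcM -subrX1.
by rewrite (le_trans (le_normcD _ _))// normcN normcX u1 expr1n Normc.normc1.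
Qed.

(* The time average of a trigonometric sum is its constant coefficient. *)
Lemma coef_le_sup (I : finType) (c : I -> R) (o u : I -> R[i]) (i0 : I) (B : R) :
  (forall i, 0 <= c i) -> (forall i, Normc.normc (o i) = 1) ->
  (forall i, Normc.normc (u i) = 1) -> o i0 = 1 -> u i0 = 1 ->
  (forall i, i != i0 -> u i != 1) ->
  (forall q : nat, Normc.normc (\sum_i (c i)%:C * o i * u i ^+ q) <= B) ->
  c i0 <= B.
Proof.
move=> c0 o1 u1 oi0 ui0 nu TB; rewrite leNgt; apply/negP => Bc.
(* [D] bounds the total contribution of the nonconstant frequencies to the sum over [q < M],
   uniformly in [M]; letting [M] grow contradicts [B < c i0]. *)
pose D := \sum_(i | i != i0) c i * (2 / Normc.normc (u i - 1)).
have key M : M%:R * c i0 <= M%:R * B + D.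
  have E : \sum_(q < M) \sum_i (c i)%:C * o i * u i ^+ q =
     (M%:R * c i0)%:C + \sum_(i | i != i0) (c i)%:C * o i * \sum_(q < M) u i ^+ q.
    rewrite exchange_big /= (bigD1 i0)//=; congr (_ + _).
      under eq_bigr do rewrite oi0 ui0 expr1n !mulr1.
      by rewrite sumr_const card_ord rmorphM rmorph_nat mulr_natl.
    by apply: eq_bigr => i _; rewrite mulr_sumr.
  have -> : M%:R * c i0 = Normc.normc (M%:R * c i0)%:C.
    by rewrite normc_real ger0_norm// mulr_ge0.
  rewrite -[(_)%:C](addrK (\sum_(i | i != i0) (c i)%:C * o i * \sum_(q < M) u i ^+ q)).
  rewrite -E (le_trans (le_normcD _ _))// normcN lerD//.
    rewrite (le_trans (normc_sum _ _))//.
    apply: (@le_trans _ _ (\sum_(q < M) B)); first by apply: ler_sum.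
    by rewrite sumr_const card_ord mulr_natl.
  rewrite (le_trans (normc_sum _ _))// ler_sum// => i ii0.
  rewrite !Normc.normcM o1 mulr1 normc_real ger0_norm// ler_wpM2l//.
  by apply: geometric_bound => //; exact: nu.
have D0 : 0 <= D.
  by apply: sumr_ge0 => i _; rewrite mulr_ge0// divr_ge0// normc_ge0.
have cB : 0 < c i0 - B by rewrite subr_gt0.
have := archi_boundP (divr_ge0 D0 (ltW cB)); set M := Num.bound _.
rewrite ltr_pdivrMr// => h; have := key M; lra.
Qed.

(** For [N = (n + 1) M], Bernoulli's inequality gives [(1 + s) ^ N >= (M s) ^ (n + 1)], of degree
    [n + 1] in [M], while the left side is at most [((n + 2) M) ^ n]. *)
Lemma exp_dominates_poly n (s : R) : 0 < s ->
  exists N : nat, N.+1%:R ^+ n < (1 + s) ^+ N.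
Proof.
move=> s0.
have bern m : 1 + m%:R * s <= (1 + s) ^+ m.
  elim: m => [|m IH]; first by rewrite mul0r addr0 expr0.
  rewrite exprS -natr1; have := ler_wpM2l (ltW (addr_gt0 ltr01 s0)) IH.
  by have : 0 <= m%:R :> R by []; nra.
have p0 : 0 <= n.+2%:R ^+ n / s ^+ n.+1 by rewrite divr_ge0// exprn_ge0// ltW.
have := archi_boundP p0; set M := Num.bound _ => hM.
exists (n.+1 * M)%N.
have M0 : (0 < M)%N by rewrite -(ltr_nat R) (le_lt_trans p0).
have h1 : (n.+1 * M).+1%:R <= n.+2%:R * M%:R :> R.
  by rewrite -natrM ler_nat; lia.
have h2 : n.+2%:R ^+ n < M%:R * s ^+ n.+1 by rewrite -ltr_pdivrMr// exprn_gt0.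
rewrite (mulnC n.+1 M) exprM -(mulnC n.+1 M).
have h3 : (M%:R * s) ^+ n.+1 <= ((1 + s) ^+ M) ^+ n.+1.
  have Ms0 : 0 <= M%:R * s by rewrite mulr_ge0// ltW.
  by rewrite lerXn2r ?nnegrE//; have := bern M; lra.
apply: lt_le_trans h3; rewrite exprMn exprSr -mulrA.
apply: (@le_lt_trans _ _ ((n.+2%:R * M%:R) ^+ n)); first by rewrite lerXn2r ?nnegrE.
rewrite exprMn mulrC ltr_pM2l ?exprn_gt0 ?ltr0n//.
Qed.

(** The largest of the [N + 1] binomial coefficients is at least their mean. *)
Lemma max_bin N : exists2 k : nat, (k <= N)%N & (2 ^ N <= N.+1 * 'C(N, k))%N.
Proof.
pose k := [arg max_(k > ord0 : 'I_N.+1) 'C(N, k)].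
exists k; first by rewrite -ltnS.
have -> : (2 ^ N = \sum_(i < N.+1) 'C(N, i))%N.
  by rewrite -[2%N]/(1 + 1)%N expnDn; apply: eq_bigr => i _; rewrite !exp1n !muln1.
rewrite -[X in (_ <= X * _)%N]card_ord -sum_nat_const leq_sum// => i _.
by rewrite /k; case: arg_maxnP => // j _; exact.
Qed.

(** The factor [expi (- t) ^ k] has modulus 1 and shifts the frequencies so that ['C(N, k)] becomes
    the constant coefficient. *)
Lemma expi_binomial (N k : nat) (t : R) :
  (1 + expi t) ^+ N * expi (- t) ^+ k =
  \sum_(i < N.+1) 'C(N, i)%:R * expi ((Posz i - Posz k)%:~R * t).
Proof.
rewrite exprDn mulr_suml; apply: eq_bigr => i _.
rewrite expr1n mul1r -mulr_natl -mulrA -!expiX -expiD; congr (_ * expi _).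
by rewrite intrB mulrBl -!pmulrn !mulr_natl mulNrn.
Qed.

(* Weyl's argument: a Bernstein-type trigonometric polynomial concentrated near
   [x] would have a time average along the orbit exponentially smaller than its
   constant coefficient if the orbit stayed away from [x]. *)
Lemma kronecker n (a : n.-tuple R) (x : 'I_n -> R) (d : R) :
  rat_independent1 a -> 0 < d -> exists q : nat, exists z : 'I_n -> int,
    forall j, `|q%:R * tnth a j - x j - (z j)%:~R| < d.
Proof.
move=> ind d0; apply: contrapT => nex.
(* The cap at 1/2 makes [cos (2 pi d') < 1] available. *)
pose d' := Num.min d 2^-1.
have d'0 : 0 < d' by rewrite lt_min d0 invr_gt0 ltr0n.
have away q : exists j, forall m : int, d' <= `|q%:R * tnth a j - x j - m%:~R|.
  apply: contrapT => h; apply: nex; exists q.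
  have near j : {m : int | `|q%:R * tnth a j - x j - m%:~R| < d}.
    apply: cid; apply: contrapT => h'; apply: h; exists j => m.
    rewrite leNgt; apply/negP => h; apply: h'; exists m.
    by rewrite (lt_le_trans h)// ge_min lexx.
  by exists (fun j => sval (near j)) => j; exact: svalP (near j).
(* [r < 2] bounds [1 + expi t] in modulus when [t] is at distance at least [d'] from the integers;
   the maximum with 1 keeps it positive. *)
pose r := Num.max (Num.sqrt (2 + 2 * cos (2 * pi * d'))) 1.
have sqrt4 : 2 = Num.sqrt (2 ^+ 2) :> R by rewrite sqrtr_sqr ger0_norm.
have r0 : 0 < r by rewrite lt_max ltr01 orbT.
have r2 : r < 2.
  rewrite gt_max ltr1n andbT.
  rewrite [ltRHS]sqrt4 ltr_sqrt ?exprn_gt0//.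
  by have := cos_2pi_lt1 d'0; rewrite ge_min lexx orbT => /(_ isT); lra.
have s0 : 0 < 2 / r - 1 by rewrite subr_gt0 ltr_pdivlMr// mul1r.
have [N hN] := exp_dominates_poly n s0.
rewrite addrC subrK in hN.
have [k kN hk] := max_bin N.
(* At each point of the orbit one of the [n] factors is at most [r ^ N], and the others are at most
   [2 ^ N]. *)
pose B := r ^+ N * (2 ^+ N) ^+ n / 2 ^+ N : R.
pose c (f : {ffun 'I_n -> 'I_N.+1}) : R := \prod_j 'C(N, f j)%:R.
pose L (y : 'I_n -> R) (f : {ffun 'I_n -> 'I_N.+1}) : R :=
  \sum_j (Posz (f j) - Posz k)%:~R * y j.
pose f0 : {ffun 'I_n -> 'I_N.+1} := [ffun _ => inord k].
have Lf0 y : L y f0 = 0.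
  by rewrite /L big1// => j _; rewrite ffunE inordK// subrr mul0r.
have Tq q : \prod_j ((1 + expi (q%:R * tnth a j - x j)) ^+ N *
                     expi (- (q%:R * tnth a j - x j)) ^+ k) =
    \sum_f (c f)%:C * expi (- L x f) * expi (L (tnth a) f) ^+ q.
  under eq_bigr do rewrite expi_binomial.
  rewrite bigA_distr_bigA; apply: eq_bigr => f _.
  rewrite big_split /= -expi_sum -mulrA -expiX -expiD; congr (_ * expi _).
    by rewrite /c rmorph_prod; apply: eq_bigr => j _; rewrite rmorph_nat.
  rewrite -[in RHS]mulr_natl /L mulr_sumr -sumrN -big_split /=.
  by apply: eq_bigr => j _; ring.
have key : c f0 <= B.
  apply: (@coef_le_sup _ c (fun f => expi (- L x f)) (fun f => expi (L (tnth a) f)) f0 B).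
  - by move=> f; apply: prodr_ge0.
  - by move=> f; exact: normc_expi.
  - by move=> f; exact: normc_expi.
  - by rewrite Lf0 oppr0 expi0.
  - by rewrite Lf0 expi0.
  (* Rational independence: an integral frequency has all its coefficients [f j - k] equal to
     zero. *)
  - move=> f; apply: contra => /eqP/expi_eq1[m /ind mf].
    apply/eqP/ffunP => j; apply/val_inj; rewrite ffunE /= inordK//.
    by have := mf j; lia.
  - move=> q; rewrite -Tq normc_prod.
    have [j0 hj0] := away q.
    have E j : Normc.normc ((1 + expi (q%:R * tnth a j - x j)) ^+ N *
        expi (- (q%:R * tnth a j - x j)) ^+ k) =
        Num.sqrt (2 + 2 * cos (2 * pi * (q%:R * tnth a j - x j))) ^+ N.
      by rewrite Normc.normcM !normcX normc_expi expr1n mulr1 normc1Dexpi.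
    under eq_bigr do rewrite E.
    have -> : B = r ^+ N * \prod_(j < n | j != j0) 2 ^+ N.
      rewrite /B; have -> : (2 ^+ N) ^+ n = \prod_(j < n) 2 ^+ N :> R.
        by rewrite prodr_const card_ord.
      by rewrite (bigD1 j0)//= mulrCA mulrAC mulfV ?mul1r// expf_neq0.
    rewrite (bigD1 j0)//= ler_pM ?exprn_ge0 ?sqrtr_ge0//.
    + by apply: prodr_ge0 => j _; rewrite exprn_ge0 ?sqrtr_ge0.
    + rewrite lerXn2r ?nnegrE ?sqrtr_ge0 ?(ltW r0)// le_max; apply/orP; left.
      by rewrite ler_wsqrtr// lerD2l ler_pM2l// cos_2pi_away_int.
    + apply: ler_prod => j _; rewrite exprn_ge0 ?sqrtr_ge0//=.
      rewrite lerXn2r ?nnegrE ?sqrtr_ge0//.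
      rewrite [leRHS]sqrt4 ler_wsqrtr//.
      by have := cos_le1 (2 * pi * (q%:R * tnth a j - x j)); lra.
have cf0 : c f0 = 'C(N, k)%:R ^+ n.
  rewrite /c; under eq_bigr do rewrite ffunE inordK//.
  by rewrite prodr_const card_ord.
(* The constant coefficient is at least [(2 ^ N / (N + 1)) ^ n], which exceeds [B] because
   [(N + 1) ^ n < (2 / r) ^ N]. *)
have h1 : (2 ^+ N) ^+ n <= N.+1%:R ^+ n * c f0 :> R.
  rewrite cf0 -exprMn lerXn2r ?nnegrE ?exprn_ge0 ?mulr_ge0//.
  by rewrite -natrX -natrM ler_nat.
have p2 : 0 < (2 ^+ N) ^+ n :> R by rewrite !exprn_gt0.
have h2 : (2 ^+ N) ^+ n <= N.+1%:R ^+ n * B.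
  by rewrite (le_trans h1)// ler_wpM2l// exprn_ge0.
move: h2; rewrite /B leNgt => /negP; apply.
rewrite mulrA ltr_pdivrMr ?exprn_gt0// mulrA [ltRHS]mulrC ltr_pM2r//.
by move: hN; rewrite expr_div_n ltr_pdivlMr ?exprn_gt0.
Qed.

End Kronecker.

(** * Measure of boxes *)

Section LebesgueTuple.
Variable R : realType.
Local Notation RM := (measurableTypeR R).

Let shift1 (v : R) (x : RM) : RM := x + v.

Let measurable_shift1 v : measurable_fun [set: RM] (shift1 v).
Proof. by apply: measurable_realfun.measurable_funD => //; exact: measurable_cst. Qed.

Lemma lebesgue_measure_shift (v : R) (A : set RM) : measurable A ->
  lebesgue_measure (shift1 v @^-1` A) = lebesgue_measure A.
Proof.
move=> mA; apply/esym.
have := @lebesgue_measure_unique R (pushforward lebesgue_measure (shift1 v)).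
apply; last exact: mA.
move=> _ [[a b]] _ <- /=.
rewrite /pushforward.
have -> : shift1 v @^-1` `]a, b] = `]a - v, b - v]%classic.
  by apply/seteqP; split => x /=; rewrite !in_itv /= /shift1 ltrBlDr lerBrDr.
rewrite !lebesgue_measure_itv/= !lte_fin ltrD2r; case: ifP => // _.
by rewrite -!EFinB; congr EFin; ring.
Qed.

Definition shift_tuple n (v : 'I_n -> R) (t : n.-tuple RM) : n.-tuple RM :=
  [tuple tnth t j + v j | j < n].

Lemma measurable_shift_tuple n (v : 'I_n -> R) :
  measurable_fun [set: n.-tuple RM] (shift_tuple v).
Proof.
apply/measurable_fun_tnthP => j.
rewrite (_ : _ \o _ = shift1 (v j) \o (@tnth n RM ^~ j)); last first.
  by apply/funext => t /=; rewrite /shift_tuple tnth_mktuple.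
by apply: measurableT_comp; [exact: measurable_shift1|exact: measurable_tnth].
Qed.

(** By induction, the shifted measure agrees with the product measure on rectangles, so uniqueness
    of the product measure applies. *)
Lemma lebesgue_tuple_shift n (v : 'I_n -> R) (A : set (n.-tuple RM)) :
  measurable A -> lebesgue_tuple R n (shift_tuple v @^-1` A) = lebesgue_tuple R n A.
Proof.
elim: n v A => [|n IHn] v A mA.
  by congr (_ _); apply/seteqP; split => t /=; rewrite (tuple0 t) (tuple0 (shift_tuple _ _)).
pose v' j := v (lift ord0 j).
pose f (p : RM * n.-tuple RM) : RM * n.-tuple RM := (shift1 (v ord0) p.1, shift_tuple v' p.2).
have mf : measurable_fun setT f.
  apply: measurable_fun_pair.
    by apply: measurableT_comp => //; exact: measurable_shift1.
  by apply: measurableT_comp => //; exact: measurable_shift_tuple.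
pose B := @pair_cons R n @^-1` A.
have mB : measurable B by rewrite -[X in measurable X]setTI; exact: measurable_pair_cons.
rewrite /= /lebesgue_cons /pushforward -/B.
have -> : @pair_cons R n @^-1` (shift_tuple v @^-1` A) = f @^-1` B.
  apply/funext => -[x t]; rewrite /B /preimage /mkset; congr (A _).
  apply: eq_from_tnth => j; rewrite tnth_mktuple.
  case: (unliftP ord0 j) => [k ->|->]//.
  by rewrite !tnthS /= tnth_mktuple.
have := @product_measure_unique _ _ _ _ _ lebesgue_measure (lebesgue_tuple R n)
  (pushforward (@lebesgue_measure R \x lebesgue_tuple R n)%E f).
move=> /(_ mf) uniq; apply/esym/(uniq _ B mB) => A1 A2 mA1 mA2.
transitivity ((@lebesgue_measure R \x lebesgue_tuple R n)%E
  ((shift1 (v ord0) @^-1` A1) `*` (shift_tuple v' @^-1` A2))); first by [].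
rewrite product_measure1E.
- congr (_ * _)%E; [exact: lebesgue_measure_shift|exact: IHn].
- by rewrite -[X in measurable X]setTI; exact: measurable_shift1.
- by rewrite -[X in measurable X]setTI; exact: measurable_shift_tuple.
Qed.

Definition box n (x d : 'I_n -> R) : set (n.-tuple RM) :=
  [set t | forall j, x j <= tnth t j < x j + d j].

Lemma measurable_forall_tnth n (A : 'I_n -> set RM) :
  (forall j, measurable (A j)) ->
  measurable [set t : n.-tuple RM | forall j, A j (tnth t j)].
Proof.
move=> mA.
rewrite (_ : mkset _ = \bigcap_(j in [set: 'I_n]) (@tnth n RM ^~ j @^-1` A j)).
  apply: fin_bigcap_measurable => // j _.
  by rewrite -[X in measurable X]setTI; apply: measurable_tnth.
by apply/seteqP; split => t /= h j; [move=> _|]; exact: h.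
Qed.

Lemma measurable_unit_cube n :
  measurable [set t : n.-tuple RM | forall j, 0 <= tnth t j <= 1].
Proof.
rewrite (_ : mkset _ =
    [set t : n.-tuple RM | forall j, `[0, 1]%classic (tnth t j)]).
  exact: (@measurable_forall_tnth n (fun=> `[0, 1]%classic)).
by apply/seteqP; split => t /= h j; move: (h j); rewrite /= in_itv.
Qed.

Lemma boxE n (x d : 'I_n -> R) :
  box x d = [set t | forall j, `[x j, x j + d j[%classic (tnth t j)].
Proof.
by apply/seteqP; split => t /= h j; move: (h j); rewrite /= in_itv.
Qed.

Lemma measurable_box n (x d : 'I_n -> R) : measurable (box x d).
Proof.
rewrite boxE.
by apply: (@measurable_forall_tnth n (fun j => `[x j, x j + d j[%classic)) => j.
Qed.

Lemma lebesgue_tuple_boxE n (x d : 'I_n -> R) : (forall j, 0 <= d j) ->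
  lebesgue_tuple R n (box x d) = (\prod_j d j)%:E.
Proof.
move=> d0; rewrite boxE.
rewrite (@lebesgue_tuple_box R n (fun j => `[x j, x j + d j[%classic))//.
rewrite -prodEFin; apply: eq_bigr => j _.
rewrite lebesgue_measure_itv/= lte_fin ltrDl -EFinD.
have [->|/eqP nd] := eqVneq (d j) 0; first by rewrite ltxx.
by rewrite lt_neqAle d0 eq_sym; case: eqP => //= _; congr EFin; ring.
Qed.

End LebesgueTuple.

(** * Disjoint boxes along the orbit and Dirichlet's theorem *)

Section Packing.
Variable R : realType.
Local Notation RM := (measurableTypeR R).

Lemma dist_int_lt (x r : R) : dist_int x < r -> exists m : int, `|x - m%:~R| < r.
Proof.
move=> h; have := @inf_lt R [set `|x - m%:~R| | m in [set: int]] r.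
have ne : [set `|x - m%:~R| | m in [set: int]] !=set0 by exists `|x - 0%:~R|, 0.
by move=> /(_ ne h) [_ [m _ <-] hm]; exists m.
Qed.

Lemma dist_int_le (x : R) (m : int) : dist_int x <= `|x - m%:~R|.
Proof.
by apply: inf_lbound; [exists 0 => _ [k _ <-]|exists m].
Qed.

Definition fracp (x : R) : R := x - (Num.floor x)%:~R.

Lemma fracp_itv x : 0 <= fracp x < 1.
Proof.
rewrite /fracp subr_ge0 Num.Theory.floor_le/= ltrBlDl.
by have := floorD1_gt x; rewrite intrD.
Qed.

(* Intersecting boxes at [p a] and [q a] would give the return time [q - p]. *)
Lemma packing n (a : n.-tuple R) (d : 'I_n -> R) (K : nat) (Y : set (n.-tuple RM)) :
  measurable Y ->
  (forall q : nat, (0 < q < K)%N -> exists j, d j <= dist_int (q%:R * tnth a j)) ->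
  (\sum_(q < K) lebesgue_tuple R n (Y `&` box (fun j => fracp (q.+1%:R * tnth a j)) d)
    = lebesgue_tuple R n
     (Y `&` \bigcup_(q in `I_K) box (fun j => fracp (q.+1%:R * tnth a j)) d))%E.
Proof.
move=> mY hK.
pose F (q : nat) := Y `&` box (fun j => fracp (q.+1%:R * tnth a j)) d.
have mF q : measurable (F q) by apply: measurableI => //; exact: measurable_box.
have disj p q t : (p < q < K)%N -> F p t -> F q t -> False.
  move=> pqK [_ Fp] [_ Fq].
  have [|j] := hK (q - p)%N; first by lia.
  rewrite leNgt => /negP; apply.
  set mm := Num.floor (q.+1%:R * tnth a j) - Num.floor (p.+1%:R * tnth a j).
  apply: le_lt_trans (dist_int_le _ mm) _.
  have -> : (q - p)%:R * tnth a j - mm%:~R =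
    fracp (q.+1%:R * tnth a j) - fracp (p.+1%:R * tnth a j).
    by rewrite /fracp /mm intrB natrB -?[q.+1%:R]natr1 -?[p.+1%:R]natr1; [ring|lia].
  have := Fp j; have := Fq j; rewrite ltr_norml => /andP[? ?] /andP[? ?].
  by apply/andP; split; lra.
have tF : trivIset `I_K F.
  apply/trivIsetP => p q /= pK qK /eqP pq; apply/seteqP; split => // t [Fp Fq].
  have [h|h|//] := ltngtP p q.
    by apply: (disj p q t); rewrite ?h.
  by apply: (disj q p t); rewrite ?h.
rewrite setI_bigcupr (measure_fin_bigcup _ (finite_II K) tF)//.
by rewrite -fsbig_ord.
Qed.

(** Pigeonhole by volume: without such a [q] the [K] boxes would be disjoint. Their corners are in
    the unit cube and their sides are at most 1, so they lie in a cube of volume [2 ^ n]. *)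
Lemma dirichlet n (a : n.-tuple R) (d : 'I_n -> R) (K : nat) :
  (forall j, 0 < d j <= 1) -> 2 ^+ n < K%:R * \prod_j d j ->
  exists2 q : nat, (0 < q < K)%N & forall j, dist_int (q%:R * tnth a j) < d j.
Proof.
move=> dd big; apply: contrapT => nex.
have := @packing n a d K setT measurableT.
set U := \bigcup_(_ in _) _ => pack.
have hK q : (0 < q < K)%N -> exists j, d j <= dist_int (q%:R * tnth a j).
  move=> qK; apply: contrapT => h; apply: nex; exists q => // j.
  by rewrite ltNge; apply/negP => h'; apply: h; exists j.
move: big; rewrite ltNge => /negP; apply.
have mU : measurable U.
  by apply: bigcup_measurable => q _; exact: measurable_box.
have : (lebesgue_tuple R n U <= lebesgue_tuple R n (box (fun=> 0%R) (fun=> 2%R)))%E.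
  apply: le_measure; rewrite ?inE//; first exact: measurable_box.
  move=> t [q _ qt] j; have := qt j; have := fracp_itv (q.+1%:R * tnth a j).
  by have := dd j => /andP[? ?] /andP[? ?] /andP[? ?]; apply/andP; split; lra.
rewrite -[U]setTI -pack// lebesgue_tuple_boxE// prodr_const card_ord.
rewrite (eq_bigr (fun=> (\prod_j d j)%:E)); last first.
  move=> q _; rewrite setTI lebesgue_tuple_boxE// => j.
  by have /andP[/ltW] := dd j.
by rewrite sumEFin lee_fin sumr_const card_ord mulr_natl.
Qed.

End Packing.

(** * Rational independence of nonsingular vectors with positive weights *)

Section Dependent.
Variable R : realType.

Lemma powR_prod_weights n (w : n.-tuple R) (Q : nat) : weight_vector w -> (0 < Q)%N ->
  \prod_j Q%:R `^ (- tnth w j) = Q%:R^-1 :> R.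
Proof.
move=> [_ w1] Q0; have Qn0 : Q%:R != 0 :> R by rewrite pnatr_eq0 -lt0n.
have -> : Q%:R^-1 = Q%:R `^ (\sum_j - tnth w j) :> R.
  by rewrite sumrN w1 powR_inv1.
apply/esym/(big_morph (powR Q%:R)); last by rewrite powRr0.
by move=> x y; rewrite powRD// Qn0 implybT.
Qed.

(* An integer relation among the [a j] gains a factor [Q ^ w j0] in Dirichlet's
   theorem: the coordinate of least weight in the relation is controlled by the
   others. *)
Lemma nonsingular_independent n (w a : n.-tuple R) : weight_vector w ->
  (forall j, 0 < tnth w j) -> ~ singular w a -> rat_independent1 a.
Proof.
move=> hw w0 ns m k E; apply: contrapT => /existsNP[j1 /eqP mj1]; apply: ns => c c0.
pose j0 := [arg min_(j < j1 | m j != 0) tnth w j]%O.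
have [mj0 minj0] : m j0 != 0 /\ forall j, m j != 0 -> tnth w j0 <= tnth w j.
  by rewrite /j0; case: arg_minP.
pose d0 := `|m j0|%N.
have d00 : (0 < d0)%N by rewrite absz_gt0.
have d0E : d0%:R = `|(m j0)%:~R| :> R by rewrite natr_absz intr_norm.
pose S := \sum_j `|(m j)%:~R : R|.
have SE : S = d0%:R + \sum_(j | j != j0) `|(m j)%:~R : R| by rewrite /S (bigD1 j0)//= d0E.
have d0S : d0%:R <= S by rewrite SE lerDl; apply: sumr_ge0.
have S1 : 1 <= S by rewrite (le_trans _ d0S)// ler1n.
pose c' := Num.min c 1 / S.
have c'0 : 0 < c' by rewrite divr_gt0 ?lt_min ?c0//; lra.
have c'S : c' * S <= c by rewrite divfK ?ge_min ?lexx//; lra.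
have c'1 : c' <= 1.
  by rewrite ler_pdivrMr ?mul1r; [rewrite ge_min S1 orbT|lra].
pose w0' := tnth w j0.
have w0p : 0 < w0' by exact: w0.
(* Beyond the threshold [T], the gain [Q ^ w0'] absorbs the constants in the volume condition of
   [dirichlet]. *)
have [T [T0 TE]] : exists T : R, 0 <= T /\ T `^ w0' = 2 ^+ n * d0%:R / c' ^+ n.-1.
  exists ((2 ^+ n * d0%:R / c' ^+ n.-1) `^ w0'^-1); split; first exact: powR_ge0.
  have num0 : 0 <= 2 ^+ n * d0%:R :> R by rewrite mulr_ge0 ?exprn_ge0.
  have den0 : 0 <= c' ^+ n.-1 by rewrite exprn_ge0 ?(ltW c'0).
  by rewrite -powRrM mulVf ?gt_eqF// powRr1// divr_ge0.
exists (Num.bound T).+1 => // Q /= TQ.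
have Q0 : (0 < Q)%N by lia.
have Q0R : 0 < Q%:R :> R by rewrite ltr0n.
have Q1 : 1 <= Q%:R :> R by rewrite ler1n.
have wQ : 2 ^+ n * d0%:R / c' ^+ n.-1 <= Q%:R `^ w0'.
  rewrite -TE; apply: ge0_ler_powR; rewrite ?nnegrE ?(ltW w0p)//.
  by apply: le_trans (ltW (archi_boundP T0)) _; rewrite ler_nat ltnW.
(* Side 1 puts no effective constraint on the coordinate [j0], which the relation will recover; this
   is the source of the gain. *)
pose d j := if j == j0 then 1 else c' * Q%:R `^ (- tnth w j).
have Qw j : Q%:R `^ (- tnth w j) <= 1.
  by rewrite -[leRHS](powRr0 Q%:R) ler_powR// oppr_le0 ltW.
have Qw0 j : 0 < Q%:R `^ (- tnth w j) by exact: powR_gt0.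
have dd j : 0 < d j <= 1.
  rewrite /d; case: eqP => _; first by rewrite ltr01 lexx.
  by rewrite mulr_gt0//= mulr_ile1// ltW.
(* A [q < K] satisfies [d0 q <= Q]. The final denominator is [d0 q], since the relation determines
   only [d0] times the coordinate [j0]. *)
pose K := (Q %/ d0).+1.
have KQ : Q%:R / d0%:R < K%:R :> R.
  by rewrite ltr_pdivrMr ?ltr0n// -natrM ltr_nat ltn_ceil.
have prodd : \prod_j d j = c' ^+ n.-1 * Q%:R `^ w0' / Q%:R.
  rewrite (bigD1 j0)//= /d eqxx mul1r.
  under eq_bigr => j /negbTE -> do [].
  rewrite big_split /= prodr_const -mulrA; congr (_ * _).
    by rewrite cardC1 card_ord.
  rewrite -(powR_prod_weights hw)// [in RHS](bigD1 j0)//= mulrA powRN divff ?mul1r//.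
  by rewrite gt_eqF// powR_gt0.
have [q /andP[q0 qK] hq] : exists2 q : nat, (0 < q < K)%N &
    forall j, dist_int (q%:R * tnth a j) < d j.
  apply: dirichlet => //; rewrite prodd.
  apply: (@le_lt_trans _ _ (Q%:R / d0%:R * (c' ^+ n.-1 * Q%:R `^ w0' / Q%:R))); last first.
    by rewrite ltr_pM2r// divr_gt0// mulr_gt0 ?exprn_gt0// powR_gt0.
  rewrite (_ : Q%:R / d0%:R * _ = c' ^+ n.-1 * Q%:R `^ w0' / d0%:R); last first.
    have cancel (x y z : R) : x != 0 -> y != 0 -> x / y * (z / x) = z / y.
      by move=> x0 y0; field; rewrite ?x0 ?y0.
    by rewrite cancel// gt_eqF// ltr0n.
  rewrite ler_pdivlMr ?ltr0n//.
  by move: wQ; rewrite ler_pdivrMr ?exprn_gt0// (mulrC _ (c' ^+ _)).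
have p_ j : {p : int | `|q%:R * tnth a j - p%:~R| < d j}.
  by apply: cid; exact: dist_int_lt.
pose p j := sval (p_ j).
have hp j : `|q%:R * tnth a j - (p j)%:~R| < d j := svalP (p_ j).
exists (d0 * q)%N.
  by rewrite muln_gt0 d00 q0 /= mulnC -leq_divRL.
move=> j; have [->|jj0] := eqVneq j j0; last first.
  apply: le_lt_trans (dist_int_le _ (Posz d0 * p j)) _.
  rewrite intrM -pmulrn natrM -mulrA -mulrBr normrM ger0_norm//.
  apply: (@lt_le_trans _ _ (d0%:R * d j)); first by rewrite ltr_pM2l ?ltr0n.
  rewrite /d (negbTE jj0) mulrA ler_wpM2r ?(ltW (Qw0 _))//.
  by rewrite (le_trans _ c'S)// mulrC ler_wpM2l// ltW.
pose s := sgz (m j0).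
have sE : d0%:R = s%:~R * (m j0)%:~R :> R by rewrite -intrM -abszEsg -pmulrn.
have s1 : `|s%:~R : R| = 1.
  by rewrite -intr_norm normr_sgz mj0.
(* The relation gives [d0 q a_j0 = s q (k - sum of m_j a_j over j != j0)]; this integer replaces
   each [q a_j] by its approximation [p j]. *)
apply: le_lt_trans (dist_int_le _ (s * (k * Posz q - \sum_(j | j != j0) m j * p j))) _.
have -> : (d0 * q)%:R * tnth a j0 -
    (s * (k * Posz q - \sum_(j | j != j0) m j * p j))%:~R =
    - (s%:~R * \sum_(j | j != j0) (m j)%:~R * (q%:R * tnth a j - (p j)%:~R)).
  have E' : (m j0)%:~R * tnth a j0 = k%:~R - \sum_(j | j != j0) (m j)%:~R * tnth a j.
    by rewrite -E (bigD1 j0)//= addrK.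
  rewrite natrM sE -mulrA mulrCA -!mulrA.
  rewrite (_ : q%:R * _ = s%:~R * q%:R * ((m j0)%:~R * tnth a j0)); last by ring.
  rewrite E' !intrM intrB intrM -pmulrn rmorph_sum /=.
  have -> : \sum_(j | j != j0) (m j * p j)%:~R = \sum_(j | j != j0) (m j)%:~R * (p j)%:~R :> R.
    by apply: eq_bigr => i _; rewrite intrM.
  have -> : \sum_(j | j != j0) (m j)%:~R * (q%:R * tnth a j - (p j)%:~R) =
     q%:R * (\sum_(j | j != j0) (m j)%:~R * tnth a j) - \sum_(j | j != j0) (m j)%:~R * (p j)%:~R.
    rewrite mulr_sumr -sumrB; apply: eq_bigr => i _; ring.
  ring.
rewrite normrN normrM s1 mul1r; apply: le_lt_trans (ler_norm_sum _ _ _) _.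
apply: (@lt_le_trans _ _ (S * (c' * Q%:R `^ (- w0')))); last first.
  by rewrite mulrA ler_wpM2r ?(ltW (Qw0 _))// mulrC.
apply: (@le_lt_trans _ _ (\sum_(j | j != j0) `|(m j)%:~R| * (c' * Q%:R `^ (- w0')))).
  apply: ler_sum => i ii0; rewrite normrM.
  have [->|mi] := eqVneq (m i) 0; first by rewrite normr0 !mul0r.
  rewrite ler_wpM2l// (le_trans (ltW (hp i)))// /d (negbTE ii0) ler_wpM2l// ?(ltW c'0)//.
  (* Minimality of the weight at [j0] makes the other errors at most [c' Q ^ - w0']. *)
  by rewrite ler_powR// lerN2 minj0.
have cQ0 : 0 < c' * Q%:R `^ (- w0') by rewrite mulr_gt0// Qw0.
by rewrite -mulr_suml ltr_pM2r// SE ltrDr ltr0n.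
Qed.

End Dependent.

(** * The exceptional set *)

Section Bad.
Variables (R : realType) (n : nat) (w a : n.-tuple R).
Local Notation RM := (measurableTypeR R).
Local Notation lam := (lebesgue_tuple R n).

(** An explicit integer in place of [dist_int] presents each coordinate condition as a countable
    union of balls, which gives measurability. *)
Definition inhom_approx (e : R) (q : nat) : set (n.-tuple RM) :=
  [set b | forall j, exists m : int,
     `|q%:R * tnth a j - tnth b j - m%:~R| < e * q%:R `^ (- tnth w j)].

Definition bad_from (e : R) (N : nat) : set (n.-tuple RM) :=
  \bigcap_(q in [set q | (N <= q)%N]) ~` inhom_approx e q.+1.

Definition bad (e : R) : set (n.-tuple RM) := \bigcup_N bad_from e N.

Lemma measurable_inhom_approx e q : measurable (inhom_approx e q).
Proof.
apply: (@measurable_forall_tnth R n (fun j => [set x | exists m : int,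
     `|q%:R * tnth a j - x - m%:~R| < e * q%:R `^ (- tnth w j)])) => j.
rewrite (_ : mkset _ = \bigcup_(m in [set: int])
   ball (q%:R * tnth a j - m%:~R) (e * q%:R `^ (- tnth w j))).
  by apply: countable_bigcupT_measurable => // m; exact: measurable_realfun.measurable_ball.
apply/seteqP; split => x /=.
  by move=> [m hm]; exists m => //; rewrite /ball/= addrAC.
by move=> [m _]; rewrite /ball/= => hm; exists m; rewrite addrAC.
Qed.

Lemma measurable_bad_from e N : measurable (bad_from e N).
Proof.
apply: bigcap_measurable => [|q _]; first by exists N => /=.
by apply: measurableC; exact: measurable_inhom_approx.
Qed.

Lemma measurable_bad e : measurable (bad e).
Proof. by apply: bigcup_measurable => N _; exact: measurable_bad_from. Qed.

Lemma bad_from_nondecreasing e N M : (N <= M)%N -> bad_from e N `<=` bad_from e M.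
Proof. by move=> NM b h q /= Mq; apply: h => /=; exact: leq_trans Mq. Qed.

(* Only an inclusion: the tolerances [q ^ - w j] decrease along the orbit. *)
Lemma bad_shift e (q : nat) (z : 'I_n -> int) : 0 < e -> (forall j, 0 <= tnth w j) ->
  bad e `<=` shift_tuple (fun j => q%:R * tnth a j - (z j)%:~R) @^-1` bad e.
Proof.
(* If [b + q a - z] is approximated at time [p + 1], then [b] is approximated at time [p + 1 - q],
   where the tolerance is at least as large. *)
move=> e0 w0 b [N _ bN]; exists (N + q)%N => // p /= Np app.
apply: (bN (p - q)%N) => /=; first by lia.
move=> j; have [m] := app j; rewrite tnth_mktuple => hm.
exists (m - z j).
apply: le_lt_trans (lt_le_trans hm _).
  rewrite le_eqVlt; apply/orP; left; apply/eqP; congr `|_|.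
  have -> : p.+1 = ((p - q).+1 + q)%N by lia.
  by rewrite natrD intrB; ring.
rewrite ler_wpM2l ?(ltW e0)// !powRN lef_pV2 ?posrE ?powR_gt0 ?ltr0n//.
by rewrite ge0_ler_powR ?nnegrE// ler_nat; lia.
Qed.

(** Kronecker's theorem supplies a translation along the orbit that carries the half-size box into
    the full box; it preserves measure and maps [bad e] into itself. *)
Lemma half_box_le e (x y d : 'I_n -> R) : rat_independent1 a ->
  0 < e -> (forall j, 0 <= tnth w j) -> (forall j, 0 < d j) ->
  (lam (bad e `&` box x (fun j => (d j / 2)%R)) <= lam (bad e `&` box y d))%E.
Proof.
move=> ind e0 w0 d0.
pose r := \big[Num.min/1]_j (d j / 4).
have r0 : 0 < r by apply: lt_bigmin => // j _; rewrite divr_gt0.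
have rd j : r <= d j / 4 by exact: bigmin_le.
(* Aiming [d j / 4] above [y j] centres the half-size box in the full one, leaving a margin
   [d j / 4] on both sides for the error. *)
have [q [z hz]] := kronecker (fun j => y j - x j + d j / 4) ind r0.
pose v j := q%:R * tnth a j - (z j)%:~R.
rewrite -(@lebesgue_tuple_shift R n v (bad e `&` box y d)); last first.
  by apply: measurableI; [exact: measurable_bad|exact: measurable_box].
apply: le_measure; rewrite ?inE.
- by apply: measurableI; [exact: measurable_bad|exact: measurable_box].
- rewrite -[X in measurable X]setTI; apply: measurable_shift_tuple => //.
  by apply: measurableI; [exact: measurable_bad|exact: measurable_box].
move=> t [bt xt]; split; first exact: bad_shift bt.
move=> j; rewrite tnth_mktuple /v.
have := xt j; have := hz j; have := rd j; rewrite ltr_norml => rdj /andP[? ?] /andP[? ?].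
by apply/andP; split; lra.
Qed.

End Bad.

(** * Covering the unit cube by half-size boxes *)

Section Cover.
Variables (R : realType) (n : nat).
Local Notation RM := (measurableTypeR R).
Local Notation lam := (lebesgue_tuple R n).

Lemma measure_le_cover (I : finType) (A : set (n.-tuple RM)) (F : I -> set (n.-tuple RM))
    (k : \bar R) : measurable A -> (forall i, measurable (F i)) ->
  (forall i, lam (F i) <= k)%E -> A `<=` \bigcup_i F i -> (lam A <= #|I|%:R%:E * k)%E.
Proof.
move=> mA mF Fk AF.
apply: (@le_trans _ _ (\sum_(i <- enum I) lam (F i))%E); last first.
  apply: (@le_trans _ _ (\sum_(i <- enum I) k)%E); first by apply: lee_sum.
  by rewrite big_enum /= sumr_const mule_natl.
have mU s : measurable (\big[setU/set0]_(i <- s) F i) by exact: bigsetU_measurable.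
apply: (@le_trans _ _ (lam (\big[setU/set0]_(i <- enum I) F i))).
  apply: le_measure; rewrite ?inE// => t /AF[i _ Fi].
  by rewrite -bigcup_seq; exists i => //=; rewrite mem_enum.
elim: (enum I) => [|i s IH]; first by rewrite !big_nil measure0.
rewrite !big_cons (le_trans (measureU2 _ _ _))//.
by rewrite leeD2l.
Qed.

Lemma card_dffun_ord (M : 'I_n -> nat) :
  #|{dffun forall j : 'I_n, 'I_(M j)}| = (\prod_j M j)%N.
Proof.
rewrite card_dep_ffun foldrE big_map big_enum /=.
by apply: eq_bigr => j _; rewrite card_ord.
Qed.

(** A grid of step [d j / 2] needs at most [2 / d j + 1] positions in coordinate [j], the endpoint 1
    included; this is at most [4 / d j] since [d j <= 1]. *)
Lemma unit_cube_cover (A : set (n.-tuple RM)) (d : 'I_n -> R) (k : \bar R) :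
  measurable A -> (forall j, 0 < d j <= 1) -> 
  (forall x, lam (A `&` box x (fun j => (d j / 2)%R)) <= k)%E ->
  (lam (A `&` [set t | forall j, 0 <= tnth t j <= 1]%R) <=
    (4 ^+ n / \prod_j d j)%:E * k)%E.
Proof.
move=> mA dd hk.
have k0 : (0 <= k)%E by exact: le_trans (hk (fun=> 0)).
pose M j := (Num.truncn (2 / d j)).+1.
pose x (f : {dffun forall j : 'I_n, 'I_(M j)}) (j : 'I_n) : R := (f j)%:R * (d j / 2).
have mC := @measurable_unit_cube R n.
have := @measure_le_cover _ _ (fun f => A `&` box (x f) (fun j => d j / 2)) k
  (measurableI _ _ mA mC).
move=> /(_ _ _ _) H; apply: le_trans (H _ _ _) _.
- by move=> f; apply: measurableI => //; exact: measurable_box.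
- by move=> f; exact: hk.
- move=> t [At t01].
  have lt j : (Num.truncn (tnth t j / (d j / 2)) < M j)%N.
    rewrite ltnS le_truncn// invf_div mulrA ler_pM2r ?invr_gt0; last by case/andP: (dd j).
    by have := t01 j; lra.
  exists [ffun j => Ordinal (lt j)] => //; split => // j.
  have d0 : 0 < d j / 2 by have := dd j; lra.
  rewrite /x ffunE /=.
  have /truncn_itv : 0 <= tnth t j / (d j / 2).
    by rewrite divr_ge0 ?(ltW d0)//; have := t01 j; lra.
  by rewrite ler_pdivlMr// ltr_pdivrMr// -[(Num.truncn _).+1%:R]natr1 mulrDl mul1r.
rewrite lee_wpmul2r// lee_fin card_dffun_ord natr_prod.
have -> : 4 ^+ n / \prod_j d j = \prod_j (4 / d j).
  by rewrite big_split /= prodr_const card_ord prodfV.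
apply: ler_prod => j _; rewrite ler0n /=.
have /andP[d0 d1] := dd j.
rewrite /M -[_.+1%:R]natr1.
have : (Num.truncn (2 / d j))%:R <= 2 / d j by rewrite truncn_le divr_ge0// ltW.
rewrite !ler_pdivlMr// mulrDl; lra.
Qed.

End Cover.

(** * Nullity of the exceptional set and the lower limit *)

Section Null.
Variables (R : realType) (n : nat) (w a : n.-tuple R).
Local Notation RM := (measurableTypeR R).
Local Notation lam := (lebesgue_tuple R n).

Lemma nonsingularP : ~ singular w a ->
  exists2 c : R, 0 < c & forall N : nat, exists2 Q : nat, (N <= Q)%N &
    forall q : nat, (1 <= q <= Q)%N ->
      exists j, c * Q%:R `^ (- tnth w j) <= dist_int (q%:R * tnth a j).
Proof.
move=> ns; apply: contrapT => h; apply: ns => c c0.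
apply: contrapT => h'; apply: h; exists c => // N.
apply: contrapT => h2; apply: h'; exists N => // Q /= NQ.
apply: contrapT => h3; apply: h2; exists Q => // q qQ.
apply: contrapT => h4; apply: h3; exists q => // j.
by rewrite ltNge; apply/negP => h5; apply: h4; exists j.
Qed.

(** A set of finite measure containing every box with corner in [[0, 1)^n] and sides at most 1. *)
Let big := box (fun=> 0) (fun=> 2) : set (n.-tuple RM).
Let cube := [set t : n.-tuple RM | forall j, 0 <= tnth t j <= 1].

(** The covering estimate is averaged over the [Q] boxes at the orbit, which are disjoint because
    [e <= c]. The first [N] boxes have total volume [N e ^ n / Q] and account for the last term; the
    others meet [bad] only outside [bad_from N]. *)
Lemma bad_cube_bound (c e : R) (Q N : nat) : rat_independent1 a -> weight_vector w ->
  0 < e -> e <= c -> e <= 1 -> (0 < Q)%N ->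
  (forall q : nat, (1 <= q <= Q)%N ->
      exists j, c * Q%:R `^ (- tnth w j) <= dist_int (q%:R * tnth a j)) ->
  (lam (bad w a e `&` cube) <=
    ((4 / e) ^+ n)%:E * lam ((bad w a e `\` bad_from w a e N) `&` big)
    + (4 ^+ n * N%:R / Q%:R)%:E)%E.
Proof.
move=> ind hw e0 ec e1 Q0 sepQ.
have w0 j : 0 <= tnth w j by have [/(_ j)/andP[]] := hw.
have Q0R : 0 < Q%:R :> R by rewrite ltr0n.
have Q1R : 1 <= Q%:R :> R by rewrite ler1n.
pose d j := e * Q%:R `^ (- tnth w j).
have d0 j : 0 < d j by rewrite mulr_gt0// powR_gt0.
have Qw j : Q%:R `^ (- tnth w j) <= 1.
  by rewrite -[leRHS](powRr0 Q%:R) ler_powR// oppr_le0.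
have dd j : 0 < d j <= 1 by rewrite d0 mulr_ile1// ?ltW// powR_gt0.
have prodd : \prod_j d j = e ^+ n / Q%:R.
  by rewrite big_split /= prodr_const card_ord powR_prod_weights.
(* This point serves as the lower corner of a box. *)
pose ctr q (j : 'I_n) := fracp (q.+1%:R * tnth a j).
have mB := @measurable_bad R n w a e.
have mBN := @measurable_bad_from R n w a e N.
have mbox x y : measurable (box x y : set (n.-tuple RM)) by exact: measurable_box.
have L_le q : (lam (bad w a e `&` cube) <=
   (4 ^+ n / \prod_j d j)%:E * lam (bad w a e `&` box (ctr q) d))%E.
  by apply: unit_cube_cover => // x; exact: half_box_le.
have mbig : measurable big by exact: measurable_box.
have mrest : measurable ((bad w a e `\` bad_from w a e N) `&` big).
  by apply: measurableI => //; exact: measurableD.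
pose U := \bigcup_(q in `I_Q) box (ctr q) d : set (n.-tuple RM).
have sumE : (\sum_(q < Q) lam (bad w a e `&` box (ctr q) d) = lam (bad w a e `&` U))%E.
  apply: packing => // q /andP[q0 qQ].
  have [|j hj] := sepQ q; first by rewrite q0 ltnW.
  by exists j; rewrite (le_trans _ hj)// ler_wpM2r// powR_ge0.
have mU : measurable U by apply: bigcup_measurable.
have Ubig : U `<=` big.
  move=> t [q _ qt] j; have := qt j; rewrite /ctr; have := fracp_itv (q.+1%:R * tnth a j).
  by have := dd j => /andP[? ?] /andP[? ?] /andP[? ?]; apply/andP; split; lra.
pose UN := \bigcup_(q in `I_N) box (ctr q) d : set (n.-tuple RM).
have mUN : measurable UN by apply: bigcup_measurable.
have BU : (lam (bad w a e `&` U) <=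
   lam ((bad w a e `\` bad_from w a e N) `&` big) + (N%:R * \prod_j d j)%:E)%E.
  have UNle : (lam UN <= (N%:R * \prod_j d j)%:E)%E.
    rewrite EFinM -[in leRHS](card_ord N).
    apply: (@measure_le_cover _ _ _ _ (fun q : 'I_N => box (ctr q) d)) => //.
      by move=> q; rewrite lebesgue_tuple_boxE// => j; exact: ltW.
    by move=> t [q /= qN qt]; exists (Ordinal qN).
  apply: le_trans (leeD2l _ UNle).
  apply: le_trans (measureU2 _ mrest mUN).
  apply: le_measure; rewrite ?inE//.
  - exact: measurableI.
  - exact: measurableU.
  move=> t [Bt Ut]; have [tN|tN] := pselect (bad_from w a e N t); last first.
    by left; split; [|exact: Ubig].
  right; have [q /= qQ qt] := Ut; exists q => //=.
  (* For [N <= q < Q], a point of the box at [(q + 1) a] is within [d j <= e (q + 1) ^ - w j] of it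
     modulo 1, contrary to [bad_from N]. *)
  rewrite ltnNge; apply/negP => Nq; apply: (tN q Nq) => j.
  exists (Num.floor (q.+1%:R * tnth a j)).
  have dq : d j <= e * q.+1%:R `^ (- tnth w j).
    rewrite ler_wpM2l ?(ltW e0)// !powRN lef_pV2 ?posrE ?powR_gt0 ?ltr0n//.
    by rewrite ge0_ler_powR ?nnegrE// ler_nat.
  have := qt j; rewrite /ctr /fracp => /andP[? ?].
  by rewrite ltr_norml; apply/andP; split; have := d0 j; lra.
have key : (Q%:R%:E * lam (bad w a e `&` cube) <= (4 ^+ n / \prod_j d j)%:E *
   (lam ((bad w a e `\` bad_from w a e N) `&` big) + (N%:R * \prod_j d j)%:E))%E.
  apply: (@le_trans _ _ ((4 ^+ n / \prod_j d j)%:E * lam (bad w a e `&` U))%E); last first.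
    by rewrite lee_wpmul2l// lee_fin divr_ge0 ?exprn_ge0//; apply: prodr_ge0 => j _; exact: ltW.
  rewrite -sumE ge0_sume_distrr; last by move=> q _; exact: measure_ge0.
  apply: (@le_trans _ _ (\sum_(q < Q) lam (bad w a e `&` cube))%E).
    by rewrite sumr_const card_ord mule_natl.
  by apply: lee_sum.
have Qi : Q%:R != 0 :> R by rewrite gt_eqF.
have ei : e != 0 by rewrite gt_eqF.
move: key; rewrite -lee_pdivlMl// => /le_trans; apply.
rewrite muleA -EFinM prodd muleDr//; last first.
  apply: ge0_adde_def; rewrite inE ?measure_ge0// lee_fin.
  by rewrite mulr_ge0// divr_ge0// exprn_ge0// ltW.
have eni : e ^+ n != 0 by rewrite expf_neq0.
rewrite -EFinM; apply: leeD.
  rewrite le_eqVlt; apply/orP; left; apply/eqP; congr (_%:E * _)%E.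
  rewrite expr_div_n.
  by move: (4 ^+ n) (e ^+ n) eni => D E Ei; field; rewrite Qi Ei.
rewrite lee_fin le_eqVlt; apply/orP; left; apply/eqP.
by move: (4 ^+ n) (e ^+ n) eni => D E Ei; field; rewrite Qi Ei.
Qed.

Lemma bad_cube_null (c e : R) : rat_independent1 a -> weight_vector w ->
  0 < e -> e <= c -> e <= 1 ->
  (forall N : nat, exists2 Q : nat, (N <= Q)%N &
    forall q : nat, (1 <= q <= Q)%N ->
      exists j, c * Q%:R `^ (- tnth w j) <= dist_int (q%:R * tnth a j)) ->
  lam.-negligible (bad w a e `&` cube).
Proof.
move=> ind hw e0 ec e1 sep.
have mC : measurable cube by exact: measurable_unit_cube.
have mB := @measurable_bad R n w a e.
have mbig : measurable big by exact: measurable_box.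
exists (bad w a e `&` cube); split => //; first exact: measurableI.
apply/eqP; rewrite eq_le measure_ge0 andbT.
pose G N := (bad w a e `\` bad_from w a e N) `&` big.
have mG N : measurable (G N).
  by apply: measurableI => //; apply: measurableD => //; exact: measurable_bad_from.
have bigfin : (lam big < +oo)%E by rewrite lebesgue_tuple_boxE// ltry.
have Gfin N : (lam (G N) < +oo)%E.
  by apply: le_lt_trans bigfin; apply: le_measure; rewrite ?inE// => t [].
(* Continuity from above: the [G N] decrease to the empty set, since [bad] is the union of the
   [bad_from N], and have finite measure. *)
have G0 : (lam \o G) N @[N --> \oo] --> 0%E.
  have GE : \bigcap_N G N = set0.
    apply/seteqP; split => // t Gt.
    have [[[N _ tN] _] _] := Gt 0%N I.
    by have [[_]] := Gt N I.
  have mcap : measurable (\bigcap_N G N) by rewrite GE.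
  have nG : {homo G : M N / (M <= N)%N >-> (N <= M)%O}.
    move=> M N MN; apply/subsetPset => t [[Bt Nt] bt]; split => //; split => // h.
    by apply: Nt; exact: bad_from_nondecreasing h.
  have := nonincreasing_cvg_mu (Gfin 0%N) mG mcap nG.
  by rewrite GE measure0.
apply/lee_addgt0Pr => r r0; rewrite add0e.
pose C := (4 / e) ^+ n.
have C0 : 0 < C by rewrite exprn_gt0// divr_gt0.
(* [C] depends on neither [N] nor [Q], so [N] can be fixed first and [Q] taken large afterwards. *)
have [N hN] : exists N, (lam (G N) < (r / 2 / C)%:E)%E.
  have pos : 0 < r / 2 / C by rewrite !divr_gt0.
  have [N _ hN] := G0 _ (@nbhs_open_ereal_lt R 0 (fun=> r / 2 / C) pos).
  by exists N; exact: (hN N (leqnn N)).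
pose s : R := 4 ^+ n * N%:R / (r / 2).
have s0 : 0 <= s by rewrite divr_ge0 ?mulr_ge0 ?exprn_ge0 ?(ltW r0)//; lra.
have [Q hQ sepQ] := sep (Num.bound s).+1.
have Q0 : (0 < Q)%N by lia.
have sQ : s <= Q%:R.
  by apply: le_trans (ltW (archi_boundP s0)) _; rewrite ler_nat ltnW.
apply: le_trans (bad_cube_bound N ind hw e0 ec e1 Q0 sepQ) _.
have -> : r = C * (r / 2 / C) + r / 2.
  by rewrite mulrC divfK ?gt_eqF// -splitr.
rewrite EFinD leeD//.
  by rewrite EFinM lee_pmul2l// ?lte_fin// ltW.
rewrite lee_fin ler_pdivrMr ?ltr0n//.
by move: sQ; rewrite /s ler_pdivrMr ?divr_gt0// (mulrC Q%:R).
Qed.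

Lemma inhom_max_lt (b : n.-tuple R) (e : R) (q : nat) : 0 < e ->
  inhom_approx w a e q.+1 b -> inhom_max w a b q.+1 < e.
Proof.
move=> e0 h; apply: bigmax_lt => // j _.
have [m hm] := h j.
have Qw : 0 < q.+1%:R `^ tnth w j :> R by rewrite powR_gt0.
rewrite mulrC -ltr_pdivlMr//; apply: le_lt_trans (dist_int_le _ m) _.
by move: hm; rewrite powRN.
Qed.

(** Every tail infimum is zero: for each [k], being outside [bad (e k)] gives arbitrarily late [q]
    with maximum below [e k]. *)
Lemma limn_einf_inhom_max (b : n.-tuple R) (e : nat -> R) :
  (forall k, 0 < e k) -> e k @[k --> \oo] --> 0 ->
  (forall k, ~ bad w a (e k) b) ->
  limn_einf (fun q => (inhom_max w a b q.+1)%:E) = 0%E.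
Proof.
move=> e0 elim nb.
rewrite limn_einf_lim.
have einf0 N : einfs (fun q => (inhom_max w a b q.+1)%:E) N = 0%E.
  apply/eqP; rewrite eq_le; apply/andP; split; last first.
    apply: le_ereal_inf_tmp => _ [q /= Nq <-]; rewrite lee_fin.
    exact: Order.TotalTheory.bigmax_ge_id.
  apply/lee_addgt0Pr => r r0; rewrite add0e.
  have [k ek] : exists k, e k < r.
    have /cvgrPdist_lt/(_ r r0)[k _ hk] := elim.
    exists k; have := hk k (leqnn k); rewrite /= sub0r normrN.
    by apply: le_lt_trans; exact: ler_norm.
  have [q [Nq hq]] : exists q, (N <= q)%N /\ inhom_approx w a (e k) q.+1 b.
    apply: contrapT => h; apply: (nb k); exists N => // q /= Nq app.
    by apply: h; exists q.
  apply: (@le_trans _ _ (inhom_max w a b q.+1)%:E).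
    by apply: ereal_inf_lbound; exists q.
  by rewrite lee_fin ltW// (lt_trans (inhom_max_lt _ hq)).
by rewrite (_ : einfs _ = fun=> 0%E) ?lim_cst//; apply/funext.
Qed.

End Null.

Theorem theorem4p8 (R : realType) (n : nat) (w a : n.-tuple R)
  (hw : weight_vector w)
  (ha : ~ singular w a)
  (h0 : (exists j, tnth w j = 0) -> rat_independent1 a) :
  {ae lebesgue_tuple R n, forall b : n.-tuple R,
    (forall j, 0 <= tnth b j <= 1) ->
    limn_einf (fun q => (inhom_max w a b q.+1)%:E) = 0%E}.
Proof.
have ind : rat_independent1 a.
  have [|npos] := pselect (exists j, tnth w j = 0); first exact: h0.
  apply: (nonsingular_independent hw _ ha) => j.
  rewrite lt_neqAle; have [/(_ j)/andP[-> _] _] := hw; rewrite andbT eq_sym.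
  by apply/eqP => wj; apply: npos; exists j.
have [c c0 sep] := nonsingularP ha.
(* A countable sequence of tolerances tending to 0, each at most [c] and 1 as [bad_cube_null]
   requires, so that the union of the exceptional sets stays null. *)
pose e (k : nat) : R := Num.min c 1 * k.+1%:R^-1.
have m0 : 0 < Num.min c 1 by rewrite lt_min c0 ltr01.
have e0 k : 0 < e k by rewrite mulr_gt0// invr_gt0.
have em k : e k <= Num.min c 1 by rewrite ger_pMr// invf_le1// ler1n.
have elim : e k @[k --> \oo] --> 0.
  rewrite -(mulr0 (Num.min c 1)); apply: cvgM; first exact: cvg_cst.
  exact: cvg_harmonic.
have nul : (lebesgue_tuple R n).-negligible
    (\bigcup_k (bad w a (e k) `&` [set t | forall j, 0 <= tnth t j <= 1])).
  apply: negligible_bigcup => k.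
  by apply: (@bad_cube_null _ _ _ _ c) => //; rewrite (le_trans (em k))// ge_min lexx ?orbT.
apply: negligibleS nul => b /= /not_implyP[b01 nlim].
apply: contrapT => nb; apply: nlim; apply: (limn_einf_inhom_max e0 elim) => k bk.
by apply: nb; exists k.
Qed.
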